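(* The modules $TS^4_\theta$ and $M$ are isomorphic as right $S^4_{\theta,\mathrm{loc}}$-modules.
   Context: Let $\theta\in[0,1)$ and $q=e^{i2\pi\theta}$. $S^4_\theta$ is the unital $\ast$-algebra over $\mathbb{C}$ generated by $Z,W,T$ with relations $WZ=qZW$, $W^*Z=\bar q ZW^*$, $ZZ^*+WW^*+T^2=1$, $T^*=T$, $[T,Z]=[T,W]=[W,W^*]=[Z,Z^*]=0$. The elements $|Z|^2:=ZZ^*$, $|W|^2:=WW^*$ and $T$ are central. Put $X^1=\frac12(Z+Z^* )$, $X^2=\frac1{2i}(Z-Z^* )$, $X^3=\frac12(W+W^* )$, $X^4=\frac1{2i}(W-W^* )$, $X^5=T$, so that $\sum_{i=1}^5(X^i)^2=1$. $S^4_{\theta,\mathrm{loc}}$ is the localization of $S^4_\theta$ at the multiplicative set generated by the central elements $1,|Z|^2,|W|^2,1-T^2,1+T^2$. Both modules are considered over the local algebra, as submodules of the free right module $(S^4_{\theta,\mathrm{loc}})^5$: $M$ is the right $S^4_{\theta,\mathrm{loc}}$-submodule generated by $E_1=(-X^2(1-T^2),X^1(1-T^2),0,0,0)$, $E_2=(0,0,-X^4(1-T^2),X^3(1-T^2),0)$, $E_3=(X^1|W|^2,X^2|W|^2,-X^3|Z|^2,-X^4|Z|^2,0)$, $E_4=(X^1T,X^2T,X^3T,X^4T,T^2-1)$. $TS^4_\theta$ is the image of the projector $\mathcal P$ on the free module defined by $\mathcal P(U)^i=U^i-\sum_{j=1}^5X^iX^jU^j$ for $i=1,\dots,5$, where $U=(U^1,\dots,U^5)$.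 *)

(* Defs.v *)
From HB Require Import structures.
From mathcomp Require Import all_boot all_order all_algebra.
From mathcomp Require Import generic_quotient.
From mathcomp Require Import boolp classical_sets reals trigo.
From mathcomp Require Import complex.

Set Implicit Arguments.
Unset Strict Implicit.
Unset Printing Implicit Defensive.

Import Order.TTheory GRing.Theory Num.Theory.
Local Open Scope ring_scope.
Local Open Scope quotient_scope.

(* Localization of a possibly noncommutative ring at a set of central         *)
(* elements: fractions a / s, with s in the multiplicative set generated by G *)
Section Localization.
Variables (A : pzRingType) (G : set A).

Inductive mulset_gen : A -> Prop :=
| mulset_gen_one : mulset_gen 1
| mulset_gen_mem g : G g -> mulset_gen g
| mulset_gen_mul s t : mulset_gen s -> mulset_gen t -> mulset_gen (s * t).

Definition central_set := forall g, G g -> forall a : A, g * a = a * g.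

Record fraction :=
  Fraction { num : A; den : A; den_mulset_gen : mulset_gen den }.

HB.instance Definition _ := gen_eqMixin fraction.
HB.instance Definition _ := gen_choiceMixin fraction.

(* The extra factor u accounts for zero divisors in the multiplicative set. *)
Definition fraction_eq (x y : fraction) : bool :=
  `[< exists2 u, mulset_gen u & u * (num x * den y) = u * (num y * den x) >].

Definition fraction0 := Fraction 0 mulset_gen_one.
Definition fraction1 := Fraction 1 mulset_gen_one.
Definition fraction_opp x := Fraction (- num x) (den_mulset_gen x).
Definition fraction_add x y :=
  Fraction (num x * den y + num y * den x)
           (mulset_gen_mul (den_mulset_gen x) (den_mulset_gen y)).
Definition fraction_mul x y :=
  Fraction (num x * num y)
           (mulset_gen_mul (den_mulset_gen x) (den_mulset_gen y)).

Hypothesis cG : central_set.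

Lemma mulset_genC s : mulset_gen s -> forall a, s * a = a * s.
Proof.
elim=> [a|g /cG //|s1 s2 _ IH1 _ IH2 a]; first by rewrite mul1r mulr1.
by rewrite -mulrA IH2 mulrA IH1 mulrA.
Qed.

Lemma denC x a : a * den x = den x * a.
Proof. exact/esym/mulset_genC/den_mulset_gen. Qed.

Lemma denCA x a b : a * (den x * b) = den x * (a * b).
Proof. by rewrite mulrA denC mulrA. Qed.

Lemma fraction_eqP x y : reflect
  (exists2 u, mulset_gen u & u * (num x * den y) = u * (num y * den x))
  (fraction_eq x y).
Proof. exact: asboolP. Qed.

Lemma fraction_eq_refl : reflexive fraction_eq.
Proof. by move=> x; apply/fraction_eqP; exists 1 => //; constructor. Qed.

Lemma fraction_eq_sym : symmetric fraction_eq.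
Proof.
by move=> x y; apply/fraction_eqP/fraction_eqP => -[u Gu e]; exists u.
Qed.

Lemma fraction_eq_trans : transitive fraction_eq.
Proof.
move=> y x z /fraction_eqP[u Gu exy] /fraction_eqP[v Gv eyz].
apply/fraction_eqP; exists (u * (v * den y)).
  by apply: mulset_gen_mul Gu (mulset_gen_mul Gv (den_mulset_gen y)).
transitivity (v * (u * (num x * den y)) * den z).
  by rewrite [v * (u * _)]mulrA (mulset_genC Gv u) -!mulrA (denCA y (num x)).
rewrite exy; transitivity (u * (v * (num y * den z)) * den x).
  rewrite [v * (u * _)]mulrA (mulset_genC Gv u) -!mulrA.
  by rewrite (denC z (den x)).
by rewrite eyz -!mulrA (denCA y (num z)).
Qed.

Definition fraction_equiv :=
  EquivRel fraction_eq fraction_eq_refl fraction_eq_sym fraction_eq_trans.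

Definition localization := {eq_quot fraction_equiv}.

Local Notation L := localization.
HB.instance Definition _ := Choice.on L.
HB.instance Definition _ := EqQuotient.on L.

Lemma localizationP (x y : fraction) :
  (exists2 u, mulset_gen u & u * (num x * den y) = u * (num y * den x)) <->
  \pi_L x = \pi_L y.
Proof.
split=> [h|h]; first by apply/eqmodP/fraction_eqP.
by apply/fraction_eqP; move/eqmodP: h.
Qed.

Lemma eq_localization (x y : fraction) :
  num x = num y -> den x = den y -> \pi_L x = \pi_L y.
Proof.
by move=> en ed; apply/localizationP; exists 1; [constructor | rewrite en ed].
Qed.

Definition loc_zero : L := \pi fraction0.
Definition loc_one : L := \pi fraction1.
Definition loc_opp := lift_op1 L fraction_opp.
Definition loc_add := lift_op2 L fraction_add.
Definition loc_mul := lift_op2 L fraction_mul.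

Lemma repr_loc x : exists2 u, mulset_gen u &
  u * (num x * den (repr (\pi_L x))) = u * (num (repr (\pi_L x)) * den x).
Proof. by apply/localizationP; rewrite reprK. Qed.

Lemma pi_loc_opp : {morph \pi_L : x / fraction_opp x >-> loc_opp x}.
Proof.
move=> x; unlock loc_opp; apply/localizationP; have [u Gu e] := repr_loc x.
by exists u => //=; rewrite !mulNr !mulrN e.
Qed.

Lemma pi_loc_add : {morph \pi_L : x y / fraction_add x y >-> loc_add x y}.
Proof.
move=> x y; unlock loc_add; apply/localizationP.
have [u Gu ex] := repr_loc x; have [v Gv ey] := repr_loc y.
move: (repr (\pi_L x)) (repr (\pi_L y)) ex ey => x' y' ex ey.
exists (u * v); rewrite /=; first exact: mulset_gen_mul.
rewrite !mulrDl !mulrDr; congr (_ + _).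
  transitivity (v * (u * (num x * den x')) * (den y * den y')).
    by rewrite [v * (u * _)]mulrA (mulset_genC Gv u) -!mulrA (denCA x' (den y)).
  by rewrite ex [v * (u * _)]mulrA (mulset_genC Gv u) -!mulrA
             (denC y' (den y)) (denCA y' (den x)).
transitivity (u * (v * (num y * den y')) * (den x * den x')).
  by rewrite -!mulrA (denC y' (den x')) (denCA y' (den x)).
by rewrite ey -!mulrA (denC x' (den x)) (denCA x' (den y)) (denC x (den y)).
Qed.

Lemma pi_loc_mul : {morph \pi_L : x y / fraction_mul x y >-> loc_mul x y}.
Proof.
move=> x y; unlock loc_mul; apply/localizationP.
have [u Gu ex] := repr_loc x; have [v Gv ey] := repr_loc y.
move: (repr (\pi_L x)) (repr (\pi_L y)) ex ey => x' y' ex ey.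
exists (u * v); rewrite /=; first exact: mulset_gen_mul.
have vC a b : a * (v * b) = v * (a * b) by rewrite mulrA -(mulset_genC Gv) mulrA.
transitivity (u * (num x * den x') * (v * (num y * den y'))).
  by rewrite -!mulrA !vC (denCA x' (num y)).
by rewrite ex ey -!mulrA !vC (denCA x (num y')).
Qed.

Lemma loc_addA : associative loc_add.
Proof.
elim/quotW=> x; elim/quotW=> y; elim/quotW=> z.
rewrite -!pi_loc_add; apply: eq_localization => /=; last by rewrite mulrA.
rewrite !mulrDl -!mulrA -addrA (denC x (den z)) (denC x (den y)).
by congr (_ + (_ + _)).
Qed.

Lemma loc_addC : commutative loc_add.
Proof.
elim/quotW=> x; elim/quotW=> y; rewrite -!pi_loc_add.
by apply: eq_localization => /=; [rewrite addrC | rewrite denC].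
Qed.

Lemma loc_add0 : left_id loc_zero loc_add.
Proof.
elim/quotW=> x; rewrite -pi_loc_add; apply: eq_localization => /=.
  by rewrite mul0r add0r mulr1.
by rewrite mul1r.
Qed.

Lemma loc_addN : left_inverse loc_zero loc_opp loc_add.
Proof.
elim/quotW=> x; rewrite -pi_loc_opp -pi_loc_add; apply/localizationP.
by exists 1 => /=; [constructor | rewrite mulNr addNr !mul0r].
Qed.

HB.instance Definition _ :=
  GRing.isZmodule.Build L loc_addA loc_addC loc_add0 loc_addN.

Lemma loc_mulA : associative loc_mul.
Proof.
elim/quotW=> x; elim/quotW=> y; elim/quotW=> z; rewrite -!pi_loc_mul.
by apply: eq_localization => /=; rewrite mulrA.
Qed.

Lemma loc_mul1l : left_id loc_one loc_mul.
Proof.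
elim/quotW=> x; rewrite -pi_loc_mul.
by apply: eq_localization => /=; rewrite mul1r.
Qed.

Lemma loc_mul1r : right_id loc_one loc_mul.
Proof.
elim/quotW=> x; rewrite -pi_loc_mul.
by apply: eq_localization => /=; rewrite mulr1.
Qed.

Lemma loc_mulDl : left_distributive loc_mul loc_add.
Proof.
elim/quotW=> x; elim/quotW=> y; elim/quotW=> z.
rewrite -!(pi_loc_mul, pi_loc_add).
apply/localizationP; exists 1 => /=; first exact: mulset_gen_one.
congr (_ * _); rewrite !mulrDl -!mulrA; congr (_ + _).
  by rewrite -(denCA y (num z)) (denCA x (den z)).
by rewrite -(denCA x (num z)) (denCA x (den z)).
Qed.

Lemma loc_mulDr : right_distributive loc_mul loc_add.
Proof.
elim/quotW=> x; elim/quotW=> y; elim/quotW=> z.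
rewrite -!(pi_loc_mul, pi_loc_add).
apply/localizationP; exists 1 => /=; first exact: mulset_gen_one.
congr (_ * _); rewrite !(mulrDl, mulrDr) -!mulrA; congr (_ + _).
  by rewrite (denCA x (den z)) (denCA x (den y)).
by rewrite (denCA x (den y)) (denCA x (den y)).
Qed.

HB.instance Definition _ := GRing.Zmodule_isPzRing.Build L
  loc_mulA loc_mul1l loc_mul1r loc_mulDl loc_mulDr.

Definition to_loc (a : A) : L := \pi_L (Fraction a mulset_gen_one).

Lemma to_loc_zmod : zmod_morphism to_loc.
Proof.
move=> a b; rewrite /to_loc [RHS]/GRing.add /= [X in loc_add _ X]/GRing.opp /=.
rewrite -pi_loc_opp -pi_loc_add.
by apply: eq_localization; rewrite /= ?mulr1.
Qed.

Lemma to_loc_monoid : monoid_morphism to_loc.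
Proof.
split=> // a b; rewrite /to_loc [RHS]/GRing.mul /= -pi_loc_mul.
by apply: eq_localization; rewrite /= ?mulr1.
Qed.

HB.instance Definition _ := GRing.isZmodMorphism.Build A L to_loc to_loc_zmod.
HB.instance Definition _ := GRing.isMonoidMorphism.Build A L to_loc to_loc_monoid.

Lemma to_loc_inv s : mulset_gen s ->
  exists2 t : L, to_loc s * t = 1 & t * to_loc s = 1.
Proof.
move=> Gs; exists (\pi_L (Fraction 1 Gs));
  rewrite /to_loc [LHS]/GRing.mul /= -pi_loc_mul;
  apply/localizationP; exists 1; rewrite /= ?(mul1r, mulr1) //;
  exact: mulset_gen_one.
Qed.

End Localization.

(* Presentations of unital *-algebras: the terms of the signature of unital   *)
(* *-algebras over F in the generators I, modulo the least congruence that    *)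
(* contains the axioms of unital *-algebras and the relations.                *)
Inductive star_term (F I : Type) : Type :=
| SGen of I
| SZero
| SOne
| SOpp of star_term F I
| SAdd of star_term F I & star_term F I
| SMul of star_term F I & star_term F I
| SScale of F & star_term F I
| SStar of star_term F I.

Arguments SGen {F I}.
Arguments SZero {F I}.
Arguments SOne {F I}.

Declare Scope star_term_scope.
Delimit Scope star_term_scope with star.
Bind Scope star_term_scope with star_term.
Notation "0" := SZero : star_term_scope.
Notation "1" := SOne : star_term_scope.
Notation "- x" := (SOpp x) : star_term_scope.
Notation "x + y" := (SAdd x y) : star_term_scope.
Notation "x * y" := (SMul x y) : star_term_scope.
Notation "c *: x" := (SScale c x) : star_term_scope.
Notation "x ^*" := (SStar x) : star_term_scope.

Section StarAlgebra.
Variables (F : numClosedFieldType) (I : Type).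
Local Notation term := (star_term F I).

HB.instance Definition _ := gen_eqMixin term.
HB.instance Definition _ := gen_choiceMixin term.

Variable rel : term -> term -> Prop.

Inductive star_cong : term -> term -> Prop :=
| SC_rel x y : rel x y -> star_cong x y
| SC_refl x : star_cong x x
| SC_sym x y : star_cong x y -> star_cong y x
| SC_trans x y z : star_cong x y -> star_cong y z -> star_cong x z
| SC_opp x x' : star_cong x x' -> star_cong (- x)%star (- x')%star
| SC_add x x' y y' : star_cong x x' -> star_cong y y' ->
    star_cong (x + y)%star (x' + y')%star
| SC_mul x x' y y' : star_cong x x' -> star_cong y y' ->
    star_cong (x * y)%star (x' * y')%star
| SC_scale c x x' : star_cong x x' -> star_cong (c *: x)%star (c *: x')%star
| SC_star x x' : star_cong x x' -> star_cong (x^*)%star (x'^*)%star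
| SC_addA x y z : star_cong (x + (y + z))%star (x + y + z)%star
| SC_addC x y : star_cong (x + y)%star (y + x)%star
| SC_add0 x : star_cong (0 + x)%star x
| SC_addN x : star_cong (- x + x)%star 0%star
| SC_mulA x y z : star_cong (x * (y * z))%star (x * y * z)%star
| SC_mul1l x : star_cong (1 * x)%star x
| SC_mul1r x : star_cong (x * 1)%star x
| SC_mulDl x y z : star_cong ((x + y) * z)%star (x * z + y * z)%star
| SC_mulDr x y z : star_cong (x * (y + z))%star (x * y + x * z)%star
| SC_scaleA (a b : F) x : star_cong (a *: (b *: x))%star ((a * b)%R *: x)%star
| SC_scale1 x : star_cong (1%R *: x)%star x
| SC_scaleDr (c : F) x y : star_cong (c *: (x + y))%star (c *: x + c *: y)%star
| SC_scaleDl (a b : F) x :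
    star_cong ((a + b)%R *: x)%star (a *: x + b *: x)%star
| SC_scaleAl (c : F) x y : star_cong (c *: (x * y))%star (c *: x * y)%star
| SC_scaleAr (c : F) x y : star_cong (c *: (x * y))%star (x * (c *: y))%star
| SC_starK x : star_cong (x^*^*)%star x
| SC_starD x y : star_cong ((x + y)^*)%star (x^* + y^*)%star
| SC_starM x y : star_cong ((x * y)^*)%star (y^* * x^*)%star
| SC_starZ (c : F) x : star_cong ((c *: x)^*)%star ((c^*)%R *: x^*)%star.

Definition star_congb x y := `[< star_cong x y >].

Lemma star_congb_refl : reflexive star_congb.
Proof. by move=> x; apply/asboolP/SC_refl. Qed.

Lemma star_congb_sym : symmetric star_congb.
Proof. by move=> x y; apply/asboolP/asboolP; apply: SC_sym. Qed.

Lemma star_congb_trans : transitive star_congb.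
Proof.
by move=> y x z /asboolP xy /asboolP yz; apply/asboolP/(SC_trans xy yz).
Qed.

Definition star_equiv :=
  EquivRel star_congb star_congb_refl star_congb_sym star_congb_trans.

Definition star_algebra := {eq_quot star_equiv}.

Local Notation A := star_algebra.
HB.instance Definition _ := Choice.on A.
HB.instance Definition _ := EqQuotient.on A.

Lemma star_algebraP (x y : term) : star_cong x y <-> \pi_A x = \pi_A y.
Proof.
by split=> [h|/eqmodP/asboolP //]; apply/eqmodP/asboolP.
Qed.

Definition sa_zero : A := \pi_A 0%star.
Definition sa_one : A := \pi_A 1%star.
Definition sa_opp := lift_op1 A (fun x : term => (- x)%star).
Definition sa_add := lift_op2 A (fun x y : term => (x + y)%star).
Definition sa_mul := lift_op2 A (fun x y : term => (x * y)%star).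
Definition sa_scale (c : F) := lift_op1 A (fun x : term => (c *: x)%star).
Definition star := lift_op1 A (fun x : term => (x^*)%star).

Lemma star_repr (x : term) : star_cong x (repr (\pi_A x)).
Proof. by apply/star_algebraP; rewrite reprK. Qed.

Lemma pi_sa_opp x : \pi_A (- x)%star = sa_opp (\pi_A x).
Proof. by unlock sa_opp; apply/star_algebraP/SC_opp/star_repr. Qed.

Lemma pi_sa_add x y : \pi_A (x + y)%star = sa_add (\pi_A x) (\pi_A y).
Proof. by unlock sa_add; apply/star_algebraP/SC_add; apply: star_repr. Qed.

Lemma pi_sa_mul x y : \pi_A (x * y)%star = sa_mul (\pi_A x) (\pi_A y).
Proof. by unlock sa_mul; apply/star_algebraP/SC_mul; apply: star_repr. Qed.

Lemma pi_sa_scale c x : \pi_A (c *: x)%star = sa_scale c (\pi_A x).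
Proof. by unlock sa_scale; apply/star_algebraP/SC_scale/star_repr. Qed.

Lemma pi_star x : \pi_A (x^*)%star = star (\pi_A x).
Proof. by unlock star; apply/star_algebraP/SC_star/star_repr. Qed.

Definition pi_saE :=
  (pi_sa_opp, pi_sa_add, pi_sa_mul, pi_sa_scale, pi_star).

Local Ltac sa_axiom :=
  repeat (let x := fresh "x" in elim/quotW => x);
  rewrite -?pi_saE; apply/star_algebraP; constructor.

Lemma sa_addA : associative sa_add. Proof. by sa_axiom. Qed.
Lemma sa_addC : commutative sa_add. Proof. by sa_axiom. Qed.
Lemma sa_add0 : left_id sa_zero sa_add. Proof. by sa_axiom. Qed.
Lemma sa_addN : left_inverse sa_zero sa_opp sa_add. Proof. by sa_axiom. Qed.
HB.instance Definition _ :=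
  GRing.isZmodule.Build A sa_addA sa_addC sa_add0 sa_addN.

Lemma sa_mulA : associative sa_mul. Proof. by sa_axiom. Qed.
Lemma sa_mul1l : left_id sa_one sa_mul. Proof. by sa_axiom. Qed.
Lemma sa_mul1r : right_id sa_one sa_mul. Proof. by sa_axiom. Qed.
Lemma sa_mulDl : left_distributive sa_mul sa_add. Proof. by sa_axiom. Qed.
Lemma sa_mulDr : right_distributive sa_mul sa_add. Proof. by sa_axiom. Qed.
HB.instance Definition _ := GRing.Zmodule_isPzRing.Build A
  sa_mulA sa_mul1l sa_mul1r sa_mulDl sa_mulDr.

Lemma sa_scaleA a b v : sa_scale a (sa_scale b v) = sa_scale (a * b) v.
Proof. by move: v; sa_axiom. Qed.
Lemma sa_scale1 : left_id 1 sa_scale. Proof. by sa_axiom. Qed.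
Lemma sa_scaleDr : right_distributive sa_scale sa_add.
Proof. by move=> c; sa_axiom. Qed.
Lemma sa_scaleDl v : {morph sa_scale^~ v : a b / a + b >-> sa_add a b}.
Proof. by move: v; elim/quotW => x a b; sa_axiom. Qed.
HB.instance Definition _ := GRing.Zmodule_isLmodule.Build F A
  sa_scaleA sa_scale1 sa_scaleDr sa_scaleDl.

Lemma piD s t : \pi_A (s + t)%star = \pi_A s + \pi_A t.
Proof. exact: pi_sa_add. Qed.
Lemma piM s t : \pi_A (s * t)%star = \pi_A s * \pi_A t.
Proof. exact: pi_sa_mul. Qed.
Lemma piZ c s : \pi_A (c *: s)%star = c *: \pi_A s.
Proof. exact: pi_sa_scale. Qed.
Lemma piN s : \pi_A (- s)%star = - \pi_A s.
Proof. exact: pi_sa_opp. Qed.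

Definition piE := (piD, piM, piZ, piN, pi_star).

Implicit Types (c : F) (x y : A).

Local Ltac star_axiom :=
  repeat (let x := fresh "x" in elim/quotW => x);
  rewrite -?piE; apply/star_algebraP; constructor.

Lemma sa_scaleAl c x y : c *: (x * y) = (c *: x) * y.
Proof. by move: x y; star_axiom. Qed.

Lemma sa_scaleAr c x y : c *: (x * y) = x * (c *: y).
Proof. by move: x y; star_axiom. Qed.

Lemma starK : involutive star. Proof. by star_axiom. Qed.

Lemma starD x y : star (x + y) = star x + star y.
Proof. by move: x y; star_axiom. Qed.

Lemma starM x y : star (x * y) = star y * star x.
Proof. by move: x y; star_axiom. Qed.

Lemma starZ c x : star (c *: x) = c^* *: star x.
Proof. by move: x; star_axiom. Qed.

Definition sa_gen (i : I) : A := \pi_A (SGen i).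

Lemma star_algebra_ind (P : A -> Prop) :
  (forall i, P (sa_gen i)) -> P 1 -> (forall x y, P x -> P y -> P (x + y)) ->
  (forall x y, P x -> P y -> P (x * y)) -> (forall c x, P x -> P (c *: x)) ->
  (forall x, P x -> P (star x)) -> forall x, P x.
Proof.
move=> Pgen P1 PD PM PZ Pstar.
elim/quotW; elim=> [i|||t IH|t IHt u IHu|t IHt u IHu|c t IH|t IH];
  rewrite ?piE; [exact: Pgen| |exact: P1| |exact: PD|exact: PM|exact: PZ
                |exact: Pstar].
  by rewrite (_ : \pi_A _ = 0) // -(scale0r (1 : A)); apply: PZ.
by rewrite -scaleN1r; apply: PZ.
Qed.

(* Generators sent to complex numbers extend to *-algebra characters. *)
Fixpoint star_eval (f : I -> F) (t : term) : F :=
  match t with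
  | SGen i => f i
  | 0 => 0%R
  | 1 => 1%R
  | - x => (- star_eval f x)%R
  | x + y => (star_eval f x + star_eval f y)%R
  | x * y => (star_eval f x * star_eval f y)%R
  | c *: x => (c * star_eval f x)%R
  | x^* => ((star_eval f x)^*)%R
  end%star.

Lemma star_eval_cong (f : I -> F) :
  (forall x y : term, rel x y -> star_eval f x = star_eval f y) ->
  forall x y : term, star_cong x y -> star_eval f x = star_eval f y.
Proof.
move=> frel x y; elim=> {x y} //=; do ?by move=> *; congruence.
- by move=> *; rewrite addrA.
- by move=> *; rewrite addrC.
- by move=> *; rewrite add0r.
- by move=> *; rewrite addNr.
- by move=> *; rewrite mulrA.
- by move=> *; rewrite mul1r.
- by move=> *; rewrite mulr1.
- by move=> *; rewrite mulrDl.
- by move=> *; rewrite mulrDr.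
- by move=> *; rewrite mulrA.
- by move=> *; rewrite mul1r.
- by move=> *; rewrite mulrDr.
- by move=> *; rewrite mulrDl.
- by move=> *; rewrite mulrA.
- by move=> *; rewrite mulrCA.
- by move=> x; rewrite conjCK.
- by move=> x y; rewrite rmorphD.
- by move=> x y; rewrite rmorphM mulrC.
- by move=> c x; rewrite rmorphM.
Qed.

End StarAlgebra.

(* Right modules over a ring A are encoded as left modules over A^c.          *)
Section Submodules.
Variables (R : pzRingType) (V : lmodType R).

Definition submodule (S : submodClosed V) := {x : V | x \in S}.

HB.instance Definition _ (S : submodClosed V) :=
  SubType.on (submodule S).
HB.instance Definition _ (S : submodClosed V) :=
  [Choice of submodule S by <:].
HB.instance Definition _ (S : submodClosed V) :=
  [SubChoice_isSubLmodule of submodule S by <:].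

Definition mspan n (E : 'I_n -> V) : {pred V} :=
  fun v => `[< exists a : 'I_n -> R, v = \sum_k a k *: E k >].

Lemma mspan_closed n (E : 'I_n -> V) : submod_closed (mspan E).
Proof.
split=> [|c u v /asboolP[a ->] /asboolP[b ->]]; apply/asboolP.
  by exists (fun=> 0); rewrite big1 // => k _; rewrite scale0r.
exists (fun k => c * a k + b k); rewrite scaler_sumr -big_split /=.
by apply: eq_bigr => k _; rewrite scalerDl scalerA.
Qed.

HB.instance Definition _ n (E : 'I_n -> V) :=
  GRing.isSubmodClosed.Build R V (mspan E) (mspan_closed E).

Variables (U : lmodType R) (f : {linear U -> V}).

Definition mimage : {pred V} := fun v => `[< exists u, v = f u >].

Lemma mimage_closed : submod_closed mimage.
Proof.
split=> [|c u v /asboolP[a ->] /asboolP[b ->]]; apply/asboolP.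
  by exists 0; rewrite linear0.
by exists (c *: a + b); rewrite linearP.
Qed.

HB.instance Definition _ :=
  GRing.isSubmodClosed.Build R V mimage mimage_closed.

End Submodules.

Inductive sphere_gen := GZ | GW | GT.

Section Sphere.
Variables (R : realType) (theta : R).

(* exp (2 i pi theta) *)
Definition sphere_q : R[i] :=
  Complex (cos (2 * pi * theta)) (sin (2 * pi * theta)).

Local Notation q := sphere_q.
Local Notation tZ := (SGen GZ).
Local Notation tW := (SGen GW).
Local Notation tT := (SGen GT).

Inductive sphere_rel : star_term R[i] sphere_gen -> star_term R[i] sphere_gen -> Prop :=
| rel_WZ : sphere_rel (tW * tZ) (q *: (tZ * tW))
| rel_WsZ : sphere_rel (tW^* * tZ) ((q^*)%R *: (tZ * tW^*))
| rel_sphere : sphere_rel (tZ * tZ^* + tW * tW^* + tT * tT) 1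
| rel_Ts : sphere_rel (tT^*) tT
| rel_TZ : sphere_rel (tT * tZ) (tZ * tT)
| rel_TW : sphere_rel (tT * tW) (tW * tT)
| rel_WWs : sphere_rel (tW * tW^*) (tW^* * tW)
| rel_ZZs : sphere_rel (tZ * tZ^*) (tZ^* * tZ).

Definition S4 := star_algebra sphere_rel.
HB.instance Definition _ := GRing.PzRing.on S4.
HB.instance Definition _ := GRing.Lmodule.on S4.

Lemma S4_one_neq0 : 1 != 0 :> S4.
Proof.
apply/eqP => /star_algebraP.
pose f g : R[i] := if g is GT then 1 else 0.
move=> /(star_eval_cong (f := f)) /= e.
suff /e/eqP : forall x y, sphere_rel x y -> star_eval f x = star_eval f y.
  by rewrite oner_eq0.
by move=> x y [] /=; rewrite ?(mul0r, mulr0, add0r, mulr1, conjC0, conjC1).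
Qed.

HB.instance Definition _ := GRing.PzSemiRing_isNonZero.Build S4 S4_one_neq0.
HB.instance Definition _ :=
  GRing.Lmodule_isLalgebra.Build R[i] S4 (@sa_scaleAl _ _ sphere_rel).
HB.instance Definition _ :=
  GRing.Lalgebra_isAlgebra.Build R[i] S4 (@sa_scaleAr _ _ sphere_rel).

Definition S4star (a : S4) : S4 := star a.

Definition Z : S4 := sa_gen sphere_rel GZ.
Definition W : S4 := sa_gen sphere_rel GW.
Definition T : S4 := sa_gen sphere_rel GT.
Definition Zs : S4 := S4star Z.
Definition Ws : S4 := S4star W.
Definition sqZ : S4 := Z * Zs.
Definition sqW : S4 := W * Ws.

Local Ltac sphere_relation :=
  rewrite /Zs /Ws /S4star -?piE; apply/star_algebraP/SC_rel; constructor.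

Lemma WZ : W * Z = q *: (Z * W). Proof. by sphere_relation. Qed.
Lemma WsZ : Ws * Z = q^* *: (Z * Ws). Proof. by sphere_relation. Qed.
Lemma sphereE : sqZ + sqW + T ^+ 2 = 1.
Proof. by rewrite expr2 /sqZ /sqW; sphere_relation. Qed.
Lemma starT : S4star T = T. Proof. by sphere_relation. Qed.
Lemma TZ : T * Z = Z * T. Proof. by sphere_relation. Qed.
Lemma TW : T * W = W * T. Proof. by sphere_relation. Qed.
Lemma WWs : W * Ws = Ws * W. Proof. by sphere_relation. Qed.
Lemma ZZs : Z * Zs = Zs * Z. Proof. by sphere_relation. Qed.

Lemma S4starM a b : S4star (a * b) = S4star b * S4star a.
Proof. exact: starM. Qed.
Lemma S4starZ c a : S4star (c *: a) = c^* *: S4star a.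
Proof. exact: starZ. Qed.
Lemma S4starK : involutive S4star.
Proof. exact: starK. Qed.

Lemma normq : q * q^* = 1.
Proof.
apply/eqP; rewrite eq_complex /=; apply/andP; split; apply/eqP.
  by rewrite mulrN opprK -!expr2 cos2Dsin2.
by rewrite mulrN mulrC addNr.
Qed.

Lemma WZs : W * Zs = q^* *: (Zs * W).
Proof.
have := congr1 S4star WsZ; rewrite !(S4starM, S4starZ) S4starK conjCK.
by rewrite -/Zs => ->; rewrite scalerA mulrC normq scale1r.
Qed.

Lemma WsZs : Ws * Zs = q *: (Zs * Ws).
Proof.
have := congr1 S4star WZ; rewrite !(S4starM, S4starZ).
by rewrite -/Zs -/Ws => ->; rewrite scalerA normq scale1r.
Qed.

Lemma TZs : T * Zs = Zs * T.
Proof. by have := congr1 S4star TZ; rewrite !S4starM starT -/Zs. Qed.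

Lemma TWs : T * Ws = Ws * T.
Proof. by have := congr1 S4star TW; rewrite !S4starM starT -/Ws. Qed.

Lemma central_gens (c : S4) : c * Z = Z * c -> c * Zs = Zs * c ->
  c * W = W * c -> c * Ws = Ws * c -> c * T = T * c ->
  forall a, c * a = a * c.
Proof.
move=> cZ cZs cW cWs cT a.
suff [] : c * a = a * c /\ c * S4star a = S4star a * c by [].
elim/star_algebra_ind: a => [[]|||||] //.
- by rewrite starT.
- have -> : S4star 1 = 1.
    by rewrite -[RHS]S4starK -[S4star 1 in RHS]mul1r S4starM S4starK mul1r.
  by rewrite mulr1 mul1r.
- move=> x y [x1 x2] [y1 y2].
  have -> : S4star (x + y : S4) = S4star x + S4star y by exact: starD.
  by rewrite !(mulrDl, mulrDr) x1 x2 y1 y2.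
- move=> x y [x1 x2] [y1 y2].
  rewrite (S4starM x y); split.
    by rewrite mulrA x1 -mulrA y1 mulrA.
  by rewrite mulrA y2 -mulrA x2 mulrA.
- move=> k x [x1 x2].
  rewrite (S4starZ k x); split.
    by rewrite -scalerAr -scalerAl x1.
  by rewrite -scalerAr -scalerAl x2.
- by move=> x [x1 x2]; rewrite (S4starK x).
Qed.

Definition X1 : S4 := 2^-1 *: (Z + Zs).
Definition X2 : S4 := (2 * 'i)^-1 *: (Z - Zs).
Definition X3 : S4 := 2^-1 *: (W + Ws).
Definition X4 : S4 := (2 * 'i)^-1 *: (W - Ws).
Definition X5 : S4 := T.

Lemma ZW : Z * W = q^* *: (W * Z).
Proof. by rewrite WZ scalerA mulrC normq scale1r. Qed.
Lemma ZWs : Z * Ws = q *: (Ws * Z).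
Proof. by rewrite WsZ scalerA normq scale1r. Qed.
Lemma ZsW : Zs * W = q *: (W * Zs).
Proof. by rewrite WZs scalerA normq scale1r. Qed.
Lemma ZsWs : Zs * Ws = q^* *: (Ws * Zs).
Proof. by rewrite WsZs scalerA mulrC normq scale1r. Qed.

Lemma sqZ_central a : sqZ * a = a * sqZ.
Proof.
apply: central_gens; rewrite /sqZ.
- by rewrite -mulrA -ZZs.
- by rewrite ZZs -mulrA -ZZs.
- by rewrite -mulrA ZsW -scalerAr [RHS]mulrA WZ -scalerAl mulrA.
- by rewrite -mulrA ZsWs -scalerAr [RHS]mulrA WsZ -scalerAl mulrA.
- by rewrite -mulrA -TZs mulrA -TZ mulrA.
Qed.

Lemma sqW_central a : sqW * a = a * sqW.
Proof.
apply: central_gens; rewrite /sqW.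
- by rewrite -mulrA WsZ -scalerAr [RHS]mulrA ZW -scalerAl mulrA.
- by rewrite -mulrA WsZs -scalerAr [RHS]mulrA ZsW -scalerAl mulrA.
- by rewrite -mulrA -WWs.
- by rewrite WWs -mulrA -WWs.
- by rewrite -mulrA -TWs mulrA -TW mulrA.
Qed.

Lemma T_central a : T * a = a * T.
Proof. by apply: central_gens; rewrite ?(TZ, TZs, TW, TWs). Qed.

Definition S4den : set S4 :=
  [set 1; sqZ; sqW; 1 - T ^+ 2; 1 + T ^+ 2]%classic.

Lemma S4den_central : central_set S4den.
Proof.
move=> s + a; have T2 : T ^+ 2 * a = a * T ^+ 2.
  by rewrite expr2 -mulrA (T_central a) mulrA (T_central a) mulrA.
case=> [[[[]|]|]|] ->; [|exact: sqZ_central|exact: sqW_central| |].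
- by rewrite mul1r mulr1.
- by rewrite mulrBl mulrBr T2 mul1r mulr1.
- by rewrite mulrDl mulrDr T2 mul1r mulr1.
Qed.

Definition S4loc := localization S4den_central.
HB.instance Definition _ := GRing.PzRing.on S4loc.

Local Notation L := S4loc.

Definition S4iota : S4 -> L := to_loc S4den_central.
HB.instance Definition _ := GRing.RMorphism.on S4iota.

(* The free right module of rank 5 over L. *)
Definition free5 := 'rV[L^c]_5.
HB.instance Definition _ := GRing.Lmodule.on free5.

Definition vec5 (s : seq L) : free5 := \row_i nth 0 s i.

Local Notation x1 := (S4iota X1).
Local Notation x2 := (S4iota X2).
Local Notation x3 := (S4iota X3).
Local Notation x4 := (S4iota X4).
Local Notation t := (S4iota T).
Local Notation z2 := (S4iota sqZ).
Local Notation w2 := (S4iota sqW).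

Definition E1 := vec5 [:: - x2 * (1 - t ^+ 2); x1 * (1 - t ^+ 2); 0; 0; 0].
Definition E2 := vec5 [:: 0; 0; - x4 * (1 - t ^+ 2); x3 * (1 - t ^+ 2); 0].
Definition E3 := vec5 [:: x1 * w2; x2 * w2; - x3 * z2; - x4 * z2; 0].
Definition E4 := vec5 [:: x1 * t; x2 * t; x3 * t; x4 * t; t ^+ 2 - 1].

Definition M := submodule (mspan (fun k : 'I_4 => nth 0 [:: E1; E2; E3; E4] k)).
HB.instance Definition _ := GRing.Lmodule.on M.

Definition X (i : 'I_5) : L := S4iota (nth 0 [:: X1; X2; X3; X4; X5] i).

(* The products below are taken in L, not in L^c. *)
Definition projP_coord (u : 'I_5 -> L) (i : 'I_5) : L :=
  u i - \sum_(j < 5) X i * X j * u j.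

Definition projP (u : free5) : free5 := \row_i projP_coord (u ord0) i.

Lemma projP_coordP u v (a : L) i :
  projP_coord (fun j => u j * a + v j) i = projP_coord u i * a + projP_coord v i.
Proof.
rewrite /projP_coord; under eq_bigr => j _ do rewrite mulrDr mulrA.
by rewrite big_split /= -mulr_suml opprD addrACA -mulNr -mulrDl.
Qed.

Lemma projP_linear : linear projP.
Proof.
move=> a u v; apply/rowP => i; rewrite mxE.
have -> : (a *: u + v) ord0 = (fun j => (u ord0 j : L) * (a : L) + v ord0 j : L).
  by apply/funext => j; rewrite !mxE.
by rewrite projP_coordP !mxE.
Qed.

HB.instance Definition _ :=
  GRing.isLinear.Build L^c free5 free5 *:%R projP projP_linear.

Definition TS4 := submodule (mimage projP).
HB.instance Definition _ := GRing.Lmodule.on TS4.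

End Sphere.

(* Main.v *)
Require Import Defs.
From mathcomp Require Import all_boot all_order all_algebra.
From mathcomp Require Import reals complex.
From HB Require Import structures.
From mathcomp Require Import generic_quotient boolp classical_sets.

Set Implicit Arguments.
Unset Strict Implicit.
Unset Printing Implicit Defensive.

Import Order.TTheory GRing.Theory Num.Theory.
Local Open Scope ring_scope.
Local Open Scope quotient_scope.

(** The two modules are the same submodule of the free module: both consist of
    the vectors [u] orthogonal to the position vector, that is, with
    [normal_part u = \sum_j X j * u j = 0]. The identity is then the
    isomorphism.

    For [TS4] this holds because the projector is [u |-> u - X * normal_part u]
    and the squares of the coordinates sum to 1 ([mem_TS4]).

    For [M], the generators are orthogonal to the position vector
    ([normal_frame]) because [x1] commutes with [x2] and [x3] with [x4]; the
    two pairs need not commute with each other. Conversely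
    ([tangent_decomposition]), given a tangent [u], the last coordinate
    dictates the coefficient of [E4], since [1 - t ^+ 2] is invertible. What
    remains is a vector [v] with
    [x1 * v1 + x2 * v2 = - (x3 * v3 + x4 * v4)] and last coordinate 0. On each
    of the two planes, [E1] (resp. [E2]) is the rotational direction and [E3]
    the radial one. The matrix with rows [(-y, x)] and [(x, y)] squares to the
    scalar [x * x + y * y], an invertible central element, for each of the
    commuting pairs, so the components of [v] along these directions are
    determined in each plane ([rotation_inverse]); the displayed equation says
    precisely that the two radial components are served by one and the same
    coefficient of [E3]. *)

(** * Submodules and commuting coordinates *)

Lemma submodule_isom (R : pzRingType) (V : lmodType R) (S S' : submodClosed V) :
  S =i S' -> exists f : {linear submodule S -> submodule S'}, bijective f.
Proof.
move=> eqS; have inS' (x : submodule S) : val x \in S' by rewrite -eqS (valP x).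
pose f (x : submodule S) : submodule S' := Sub (val x) (inS' x).
have f_lin : linear f.
  by move=> a x y; apply: val_inj; rewrite !(linearP, SubK).
pose F := GRing.isLinear.Build R _ _ _ f f_lin.
pose G : {linear submodule S -> submodule S'} := HB.pack f F.
have inS (x : submodule S') : val x \in S by rewrite eqS (valP x).
by exists G; exists (fun x => Sub (val x) (inS x)) => x; apply: val_inj;
  rewrite !SubK.
Qed.

(** With [zs] in the role of the adjoint of [z], this is the passage from a
    normal element to its real and imaginary parts. *)
Lemma cartesian_coords (F : numClosedFieldType) (A : algType F) (z zs : A) :
    GRing.comm z zs ->
  let x := 2^-1 *: (z + zs) in let y := (2 * 'i)^-1 *: (z - zs) in
  GRing.comm x y /\ x * x + y * y = z * zs.
Proof.
move=> zC x y; split.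
  rewrite /GRing.comm /x /y -!scalerAl -!scalerAr !scalerA mulrC.
  by congr (_ *: _); apply: commrB; apply/commr_sym/commrD.
rewrite /x /y -!scalerAl -!scalerAr !scalerA -!invfM.
have -> : 2 * 'i * (2 * 'i) = - 4 :> F.
  by rewrite mulrACA -(expr2 'i) sqrCi mulrN1 -natrM.
have -> : 2 * 2 = 4 :> F by rewrite -natrM.
rewrite invrN scaleNr -scalerBr.
have -> : (z + zs) * (z + zs) - (z - zs) * (z - zs) = 4 *: (z * zs).
  rewrite !(mulrDl, mulrDr, mulrN, mulNr) -zC !opprD !opprK addrACA.
  rewrite [X in X + _ = _]addrACA [X in _ + X = _]addrACA !subrr add0r addr0.
  by rewrite -!mulr2n -mulrnA scaler_nat.
by rewrite scalerK // pnatr_eq0.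
Qed.

(** Cramer's rule for the matrix with rows [(-y, x)] and [(x, y)], which is its
    own adjugate up to sign. *)
Lemma rotation_inverse (A : pzRingType) (x y r r' p q : A) :
    GRing.comm x y -> x * x + y * y = r -> r' * r = 1 ->
    (forall a, GRing.comm r' a) ->
  - y * (r' * (x * q - y * p)) + x * (r' * (x * p + y * q)) = p
  /\ x * (r' * (x * q - y * p)) + y * (r' * (x * p + y * q)) = q.
Proof.
move=> xy <- r'K r'C.
have E a b : a * (r' * b) = r' * (a * b) by rewrite mulrA -r'C mulrA.
have K a : r' * (x * (x * a) + y * (y * a)) = a.
  by rewrite 2!mulrA -mulrDl mulrA r'K mul1r.
have xyA a : y * (x * a) = x * (y * a) by rewrite !mulrA xy.
rewrite !E -!mulrDr; split; rewrite -[RHS]K; congr (_ * _).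
  by rewrite mulNr mulrBr mulrDr xyA opprB addrC addrACA subrr addr0.
by rewrite mulrBr mulrDr xyA addrA subrK.
Qed.

Lemma central_inv (A : pzRingType) (c c' : A) :
  (forall a, GRing.comm c a) -> c * c' = 1 -> c' * c = 1 ->
  forall a, GRing.comm c' a.
Proof.
move=> cC cc' c'c a.
by rewrite /GRing.comm -[LHS]mulr1 -cc' mulrA -(mulrA c') -cC mulrA c'c mul1r.
Qed.

(** * Tangent vectors decompose along the frame *)

(** The right-hand sides are the coordinates of the combination of [E1], ...,
    [E4] with right coefficients [c], where [a] and [b] stand for the squared
    moduli of [Z] and [W]. *)
Lemma tangent_decomposition (A : pzRingType) (x1 x2 x3 x4 t a b a' b' d' : A)
    (u1 u2 u3 u4 u5 : A) :
    GRing.comm x1 x2 -> GRing.comm x3 x4 ->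
    x1 * x1 + x2 * x2 = a -> x3 * x3 + x4 * x4 = b ->
    a + b + t ^+ 2 = 1 ->
    (forall c, GRing.comm a c) -> (forall c, GRing.comm b c) ->
    (forall c, GRing.comm t c) ->
    a * a' = 1 -> b * b' = 1 -> (1 - t ^+ 2) * d' = 1 ->
    a' * a = 1 -> b' * b = 1 -> d' * (1 - t ^+ 2) = 1 ->
    x1 * u1 + x2 * u2 + x3 * u3 + x4 * u4 + t * u5 = 0 ->
  exists c : 'I_4 -> A, [/\
      u1 = - x2 * (1 - t ^+ 2) * c 0 + x1 * b * c 2 + x1 * t * c 3,
      u2 = x1 * (1 - t ^+ 2) * c 0 + x2 * b * c 2 + x2 * t * c 3,
      u3 = - x4 * (1 - t ^+ 2) * c 1 + - x3 * a * c 2 + x3 * t * c 3,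
      u4 = x3 * (1 - t ^+ 2) * c 1 + - x4 * a * c 2 + x4 * t * c 3
    & u5 = (t ^+ 2 - 1) * c 3].
Proof.
move=> x12 x34 ha hb; set d := 1 - t ^+ 2.
move=> abt aC bC tC aK bK dK Ka Kb Kd u_tan.
have dC c : GRing.comm d c.
  by apply/commr_sym/commrB; [exact: commr1 | exact/commrX/commr_sym].
have a'C := central_inv aC aK Ka; have b'C := central_inv bC bK Kb.
have abd : a + b = d by rewrite -(addrK (t ^+ 2) (a + b)) abt.
pose c4 := - (d' * u5).
pose v x u := u - x * t * c4.
pose v1 := v x1 u1; pose v2 := v x2 u2; pose v3 := v x3 u3; pose v4 := v x4 u4.
have vD x y u w :
    x * v x u + y * v y w = (x * u + y * w) - (x * x + y * y) * (t * c4).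
  by rewrite /v !mulrBr !mulrA addrACA -opprD -!mulrDl.
have v_tan : x1 * v1 + x2 * v2 = - (x3 * v3 + x4 * v4).
  apply/eqP; rewrite -addr_eq0 !vD ha hb addrACA -opprD -mulrDl abd.
  suff -> : d * (t * c4) = - (t * u5) by rewrite opprK addrA u_tan.
  by rewrite !mulrN dC -!mulrA -(dC u5) (mulrA d') Kd mul1r.
pose s := x1 * v1 + x2 * v2.
pose c1 := d' * (a' * (x1 * v2 - x2 * v1)).
pose c2 := d' * (b' * (x3 * v4 - x4 * v3)).
pose c3 := b' * (a' * s).
exists (fun k => nth 0 [:: c1; c2; c3; c4] k) => /=.
have dc1 x : x * d * c1 = x * (a' * (x1 * v2 - x2 * v1)).
  by rewrite /c1 !mulrA -(mulrA x) dK mulr1.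
have dc2 x : x * d * c2 = x * (b' * (x3 * v4 - x4 * v3)).
  by rewrite /c2 !mulrA -(mulrA x) dK mulr1.
have bc3 x : x * b * c3 = x * (a' * (x1 * v1 + x2 * v2)).
  by rewrite /c3 -/s !mulrA -(mulrA x) bK mulr1.
(* Tangency turns the radial coefficient of the first plane into the one of
   the second plane, with the sign that E3 carries. *)
have ac3 x : - x * a * c3 = x * (b' * (x3 * v3 + x4 * v4)).
  rewrite /c3 /s v_tan !(mulrN, mulNr) opprK (mulrA b') (b'C a') !mulrA.
  by rewrite -(mulrA x a) aK mulr1.
have [e1 e2] := rotation_inverse v1 v2 x12 ha Ka a'C.
have [e3 e4] := rotation_inverse v3 v4 x34 hb Kb b'C.
rewrite !dc1 !dc2 !bc3 !ac3 e1 e2 e3 e4 !subrK; split=> //.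
by rewrite /c4 mulrN -mulNr opprB mulrA dK mul1r.
Qed.

(** * Coordinates of the local noncommutative sphere *)

Lemma loc_central (A : pzRingType) (G : set A) (cG : central_set G) (c : A) :
  (forall a, GRing.comm c a) -> forall x, GRing.comm (to_loc cG c) x.
Proof.
move=> cC; elim/quotW => -[a s Gs].
rewrite /GRing.comm /to_loc [LHS]/GRing.mul [RHS]/GRing.mul /= -!pi_loc_mul.
by apply: eq_localization; rewrite /= ?cC // mul1r mulr1.
Qed.

Section Sphere.
Variables (R : realType) (theta : R).
Local Notation L := (S4loc theta).
Local Notation x1 := (S4iota (X1 theta)).
Local Notation x2 := (S4iota (X2 theta)).
Local Notation x3 := (S4iota (X3 theta)).
Local Notation x4 := (S4iota (X4 theta)).
Local Notation t := (S4iota (T theta)).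
Local Notation z2 := (S4iota (sqZ theta)).
Local Notation w2 := (S4iota (sqW theta)).

Lemma iota_sqZ_central (a : L) : GRing.comm z2 a.
Proof. exact/loc_central/sqZ_central. Qed.

Lemma iota_sqW_central (a : L) : GRing.comm w2 a.
Proof. exact/loc_central/sqW_central. Qed.

Lemma iota_T_central (a : L) : GRing.comm t a.
Proof. exact/loc_central/T_central. Qed.

Lemma iota_inv (c : S4 theta) : S4den c ->
  exists2 c' : L, S4iota c * c' = 1 & c' * S4iota c = 1.
Proof.
move=> cG; apply: (to_loc_inv (S4den_central (theta := theta))).
exact: mulset_gen_mem.
Qed.

Lemma coordsZ : GRing.comm x1 x2 /\ x1 * x1 + x2 * x2 = z2.
Proof.
have [xC xE] := cartesian_coords (ZZs theta).
by split; rewrite ?/GRing.comm -!rmorphM -?rmorphD; congr (S4iota _).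
Qed.

Lemma coordsW : GRing.comm x3 x4 /\ x3 * x3 + x4 * x4 = w2.
Proof.
have [xC xE] := cartesian_coords (WWs theta).
by split; rewrite ?/GRing.comm -!rmorphM -?rmorphD; congr (S4iota _).
Qed.

Lemma sphere_loc : z2 + w2 + t ^+ 2 = 1.
Proof. by rewrite -rmorphXn -!rmorphD sphereE rmorph1. Qed.

Lemma sumX2 : \sum_j X theta j * X theta j = 1.
Proof.
rewrite !big_ord_recl big_ord0 addr0 /= -sphere_loc expr2.
by rewrite -(proj2 coordsZ) -(proj2 coordsW) !addrA.
Qed.

(** * The tangent module as an orthogonal complement *)

(** The type constraint on [u ord0 j] makes the product one of [L] rather than
    of the converse ring over which [free5] is a module. *)
Definition normal_part (u : free5 theta) : L :=
  \sum_j X theta j * (u ord0 j : L).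

Lemma normal_partE u : normal_part u =
  x1 * (u ord0 0 : L) + x2 * (u ord0 1 : L) + x3 * (u ord0 2 : L)
  + x4 * (u ord0 3 : L) + t * (u ord0 4 : L).
Proof.
rewrite /normal_part !big_ord_recl big_ord0 addr0 !addrA.
have l1 : lift ord0 ord0 = 1 :> 'I_5 by exact: val_inj.
have l2 : lift ord0 (lift ord0 ord0) = 2 :> 'I_5 by exact: val_inj.
have l3 : lift ord0 (lift ord0 (lift ord0 ord0)) = 3 :> 'I_5.
  exact: val_inj.
have l4 : lift ord0 (lift ord0 (lift ord0 (lift ord0 ord0))) = 4 :> 'I_5.
  exact: val_inj.
by rewrite l1 l2 l3 l4.
Qed.

Lemma normal_part0 : normal_part 0 = 0.
Proof. by rewrite /normal_part big1 // => j _; rewrite mxE mulr0. Qed.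

Lemma normal_part_linear a u v :
  normal_part (a *: u + v) = normal_part u * a + normal_part v.
Proof.
rewrite /normal_part mulr_suml -big_split; apply: eq_bigr => j _.
by rewrite !mxE mulrDr mulrA.
Qed.

Lemma projPE (u : free5 theta) i :
  projP u ord0 i = (u ord0 i : L) - X theta i * normal_part u.
Proof.
rewrite mxE /projP_coord /normal_part mulr_sumr; congr (_ - _).
by apply: eq_bigr => j _; rewrite mulrA.
Qed.

Lemma mem_TS4 (u : free5 theta) :
  (u \in mimage (@projP R theta)) = (normal_part u == 0).
Proof.
apply/asboolP/eqP => [[v ->]|u0].
  rewrite /normal_part; under eq_bigr => j _ do rewrite projPE mulrBr mulrA.
  by rewrite sumrB -mulr_suml sumX2 mul1r subrr.
by exists u; apply/rowP => i; rewrite projPE u0 mulr0 subr0.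
Qed.

(** * The span of the frame as an orthogonal complement *)

Definition frame (k : 'I_4) : free5 theta :=
  nth 0 [:: E1 theta; E2 theta; E3 theta; E4 theta] k.

Lemma frame_sum (c : 'I_4 -> L) i :
  (\sum_k (c k : L^c) *: frame k) ord0 i =
    (E1 theta ord0 i : L) * c 0 + (E2 theta ord0 i : L) * c 1
    + (E3 theta ord0 i : L) * c 2 + (E4 theta ord0 i : L) * c 3.
Proof.
have l1 : lift ord0 ord0 = 1 :> 'I_4 by exact: val_inj.
have l2 : lift ord0 (lift ord0 ord0) = 2 :> 'I_4 by exact: val_inj.
have l3 : lift ord0 (lift ord0 (lift ord0 ord0)) = 3 :> 'I_4.
  exact: val_inj.
have scaleE (a : L) (v : free5 theta) :
  ((a : L^c) *: v) ord0 i = (v ord0 i : L) * a by rewrite mxE.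
rewrite summxE !big_ord_recl big_ord0 addr0 !scaleE.
by rewrite l1 l2 l3 !addrA.
Qed.

Lemma normal_frame k : normal_part (frame k) = 0.
Proof.
have [x12 xE] := coordsZ; have [x34 yE] := coordsW.
rewrite normal_partE; case: k => -[|[|[|[|//]]]] ? /=; rewrite !mxE /=;
  rewrite ?(mulr0, addr0, add0r).
- by rewrite mulNr mulrN !mulrA x12 addNr.
- by rewrite mulNr mulrN !mulrA x34 addNr.
- rewrite !(mulNr, mulrN) !mulrA -addrA -opprD -!mulrDl xE yE.
  by rewrite iota_sqZ_central subrr.
- rewrite !mulrA -!mulrDl -(addrA (x1 * x1 + _)) xE yE -iota_T_central.
  by rewrite -mulrDr addrA sphere_loc subrr mulr0.
Qed.

Lemma mem_M (u : free5 theta) : (u \in mspan frame) = (normal_part u == 0).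
Proof.
apply/asboolP/eqP => [[c ->]|].
  elim/big_ind: _ => [|v w v0 w0|k _]; first exact: normal_part0.
    by rewrite -[v]scale1r normal_part_linear v0 w0 mul0r addr0.
  rewrite -[_ *: _]addr0 normal_part_linear normal_frame mul0r add0r.
  exact: normal_part0.
have [x12 xE] := coordsZ; have [x34 yE] := coordsW.
have [|a' aK Ka] := @iota_inv (sqZ theta); first by rewrite /S4den /=; tauto.
have [|b' bK Kb] := @iota_inv (sqW theta); first by rewrite /S4den /=; tauto.
have [|d'] := @iota_inv (1 - T theta ^+ 2); first by rewrite /S4den /=; tauto.
rewrite rmorphB rmorph1 rmorphXn normal_partE => dK Kd u0.
have [c [e1 e2 e3 e4 e5]] := tangent_decomposition x12 x34 xE yE sphere_loc
  iota_sqZ_central iota_sqW_central iota_T_central aK bK dK Ka Kb Kd u0.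
exists c; apply/rowP => i; rewrite frame_sum !mxE.
case: i => -[|[|[|[|[|//]]]]] lti /=; rewrite !mul0r ?(add0r, addr0).
- by rewrite -e1; congr (u _ _); apply: val_inj.
- by rewrite -e2; congr (u _ _); apply: val_inj.
- by rewrite -e3; congr (u _ _); apply: val_inj.
- by rewrite -e4; congr (u _ _); apply: val_inj.
- by rewrite -e5; congr (u _ _); apply: val_inj.
Qed.

End Sphere.

(* Right modules over S4loc are left modules over the converse ring S4loc^c. *)
Theorem proposition3p9 (R : realType) (theta : R) :
  0 <= theta < 1 ->
  exists f : {linear TS4 theta -> M theta}, bijective f.
Proof.
by move=> _; apply: submodule_isom => u; rewrite mem_TS4 -mem_M.
Qed.
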